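(* Let $S$ be a $(2,\omega)$-divisible Cu-semigroup satisfying (O5), (O6) and (O7), and let $\iota\colon S_{\mathrm{soft}}\to S$ be the inclusion. Then the map $\iota^*\colon F(S)\to F(S_{\mathrm{soft}})$, $\lambda\mapsto\lambda\circ\iota$, is a homeomorphism.
   Context: A Cu-semigroup is a positively ordered commutative monoid satisfying (O1)–(O4): increasing sequences have suprema; each element is the supremum of a $\ll$-increasing sequence; $x'\ll x,y'\ll y\Rightarrow x'+y'\ll x+y$; suprema of increasing sequences are additive. $x\ll y$ means whenever $y\le\sup z_n$ for increasing $(z_n)$, $x\le z_m$ for some $m$. (O5): if $x+y\le z$, $x'\ll x$, $y'\ll y$ then some $c$ has $y'\ll c$ and $x'+c\le z\le x+c$. (O6): if $x'\ll x\le y+z$ then some $v,w$ have $v\le x,y$, $w\le x,z$, $x'\le v+w$. (O7): if $x'\ll x\le w$, $y'\ll y\le w$ then some $z$ has $x',y'\ll z\le w,x+y$. $\infty x=\sup_n nx$. $x$ is strongly soft if for every $x'\ll x$ there is $t$ with $x'+t\ll x$ and $x'\ll\infty t$; $S_{\mathrm{soft}}$ is the set of strongly soft elements, which under these hypotheses is a sub-Cu-semigroup satisfying (O5). $S$ is $(2,\omega)$-divisible if for $x'\ll x$ there is $y$ with $2y\le x$, $x'\le\infty y$. For a Cu-semigroup $T$ satisfying (O5), $F(T)$ is the set of monoid morphisms $T\to[0,\infty]$ preserving order and suprema of increasing sequences, equipped with its standard compact Hausdorff topology (the topology in which $\lambda_i\to\lambda$ iff $\limsup_i\lambda_i(x')\le\lambda(x)\le\liminf_i\lambda_i(x)$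 for all $x'\ll x$). *)

(* Defs.v *)
From HB Require Import structures.
From mathcomp Require Import all_boot all_order all_algebra.
From mathcomp Require Import all_classical all_reals ereal.
Set Implicit Arguments. Unset Strict Implicit. Unset Printing Implicit Defensive.
Import Order.TTheory GRing.Theory Num.Theory.

Record cu_ops := CuOps {
  car :> Type;
  cadd : car -> car -> car;
  czero : car;
  cle : car -> car -> Prop }.

Section CuDefs.
Variable S : cu_ops.
Local Notation "x + y" := (cadd x y).
Local Notation "0" := (czero S).
Local Notation "x <= y" := (cle x y).

Definition pos_ordered_comm_monoid : Prop :=
  (forall x y z : S, x + (y + z) = (x + y) + z) /\
  (forall x y : S, x + y = y + x) /\
  (forall x : S, x + 0 = x) /\
  (forall x : S, x <= x) /\
  (forall x y z : S, x <= y -> y <= z -> x <= z) /\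
  (forall x y : S, x <= y -> y <= x -> x = y) /\
  (forall x y z : S, x <= y -> x + z <= y + z) /\
  (forall x : S, 0 <= x).

Definition increasing (s : nat -> S) : Prop := forall n, s n <= s n.+1.

(* Notions relative to a sub-object given by a predicate P on S:
   sequences, suprema and upper bounds are all taken inside P. *)
Definition is_supP (P : S -> Prop) (s : nat -> S) (x : S) : Prop :=
  P x /\ (forall n, s n <= x) /\
  (forall y, P y -> (forall n, s n <= y) -> x <= y).

Definition llP (P : S -> Prop) (x y : S) : Prop :=
  forall (s : nat -> S) (z : S), (forall n, P (s n)) -> increasing s ->
    is_supP P s z -> y <= z -> exists m, x <= s m.

Definition allS : S -> Prop := fun _ => True.
Definition is_sup := is_supP allS.
Definition ll := llP allS.

Definition O1 : Prop := forall s, increasing s -> exists z, is_sup s z.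
Definition O2 : Prop := forall x : S, exists s : nat -> S,
  (forall n, ll (s n) (s n.+1)) /\ is_sup s x.
Definition O3 : Prop := forall x' x y' y : S,
  ll x' x -> ll y' y -> ll (x' + y') (x + y).
Definition O4 : Prop := forall (s t : nat -> S) (x y : S),
  increasing s -> increasing t -> is_sup s x -> is_sup t y ->
  is_sup (fun n => s n + t n) (x + y).

Definition is_Cu : Prop := pos_ordered_comm_monoid /\ O1 /\ O2 /\ O3 /\ O4.

Definition O5 : Prop := forall x y z x' y' : S,
  x + y <= z -> ll x' x -> ll y' y ->
  exists c, ll y' c /\ x' + c <= z /\ z <= x + c.
Definition O6 : Prop := forall x' x y z : S,
  ll x' x -> x <= y + z ->
  exists v w, v <= x /\ v <= y /\ w <= x /\ w <= z /\ x' <= v + w.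
Definition O7 : Prop := forall x' x y' y w : S,
  ll x' x -> x <= w -> ll y' y -> y <= w ->
  exists z, ll x' z /\ ll y' z /\ z <= w /\ z <= x + y.

Definition nmul (n : nat) (x : S) : S := iter n (cadd x) 0.
Definition le_infty (x y : S) : Prop :=
  exists z, is_sup (fun n => nmul n y) z /\ x <= z.

Definition strongly_soft (x : S) : Prop :=
  forall x', ll x' x -> exists t, ll (x' + t) x /\ le_infty x' t.

Definition two_omega_divisible : Prop :=
  forall x' x : S, ll x' x -> exists y, y + y <= x /\ le_infty x' y.

End CuDefs.

Section Functionals.
Variable R : realType.
Local Open Scope ereal_scope.
Variables (S : cu_ops) (P : S -> Prop).

Definition is_functional (lam : {x : S | P x} -> \bar R) : Prop :=
  (forall x, 0 <= lam x) /\
  (forall h : P (czero S), lam (exist _ (czero S) h) = 0) /\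
  (forall x y (h : P (cadd (sval x) (sval y))),
      lam (exist _ (cadd (sval x) (sval y)) h) = lam x + lam y) /\
  (forall x y, cle (sval x) (sval y) -> lam x <= lam y) /\
  (forall (s : nat -> {x : S | P x}) (z : {x : S | P x}),
      increasing (fun n => sval (s n)) ->
      is_supP P (fun n => sval (s n)) (sval z) ->
      lam z = ereal_sup [set lam (s n) | n in setT]).

Definition directed (I : Type) (leI : I -> I -> Prop) : Prop :=
  (exists i : I, True) /\
  (forall i, leI i i) /\
  (forall i j k, leI i j -> leI j k -> leI i k) /\
  (forall i j, exists k, leI i k /\ leI j k).

Definition limsup_le (I : Type) (leI : I -> I -> Prop) (a : I -> \bar R)
  (b : \bar R) : Prop :=
  forall c, b < c -> exists i0, forall i, leI i0 i -> a i < c.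
Definition le_liminf (I : Type) (leI : I -> I -> Prop) (a : I -> \bar R)
  (b : \bar R) : Prop :=
  forall c, c < b -> exists i0, forall i, leI i0 i -> c < a i.

(* convergence of nets in the standard topology of F(T):
   lam_i --> lam iff limsup lam_i(x') <= lam(x) <= liminf lam_i(x)
   for all x' << x in T. *)
Definition F_converges (I : Type) (leI : I -> I -> Prop)
  (net : I -> {x : S | P x} -> \bar R) (lam : {x : S | P x} -> \bar R)
  : Prop :=
  forall x' x : {x : S | P x}, llP P (sval x') (sval x) ->
    limsup_le leI (fun i => net i x') (lam x) /\
    le_liminf leI (fun i => net i x) (lam x).

End Functionals.

Definition iota_star (R : realType) (S : cu_ops)
  (lam : {x : S | allS x} -> \bar R) :
  {x : S | strongly_soft x} -> \bar R :=
  fun x => lam (exist _ (sval x) I).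

(* Main.v *)
Require Import Defs.
From mathcomp Require Import all_boot all_order all_algebra.
From mathcomp Require Import all_classical all_reals ereal.

Set Implicit Arguments.
Unset Strict Implicit.
Unset Printing Implicit Defensive.
Import Order.TTheory GRing.Theory Num.Theory.

(* Every soft element is the supremum of soft elements way below it, and below
   every [x] with [x' << x] there are soft [e], [f] such that [x' <= e + f],
   [f <= x] and [k e <= x], for [k] as large as we wish. Hence a functional on
   [S] is determined by its soft part through
     [lam x = sup {lam w | w soft, w <= x}],
   since the error [lam e <= lam x / k] is arbitrarily small. The same formula
   extends any functional on the soft part: subadditivity, the only delicate
   point, follows by covering approximants of [x] and [y] by soft elements of
   almost the same size. These covers also control the limits superior, so
   convergence can be tested on soft elements. *)

Section CuSemigroups.
Variable S : cu_ops.
Hypothesis CuS : is_Cu S.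
Local Notation "x + y" := (cadd x y).
Local Notation "0" := (czero S).
Local Notation "x <= y" := (cle x y).
Local Notation "x <<< y" := (ll x y) (at level 70).
Implicit Types x y z t u v w : S.

(** * Ordered monoid arithmetic and multiples *)

Lemma caddA x y z : x + (y + z) = (x + y) + z.
Proof. by case: CuS => -[]. Qed.

Lemma caddC x y : x + y = y + x.
Proof. by case: CuS => -[_ []]. Qed.

Lemma caddr0 x : x + 0 = x.
Proof. by case: CuS => -[_ [_ []]]. Qed.

Lemma cadd0r x : 0 + x = x.
Proof. by rewrite caddC caddr0. Qed.

Lemma caddACA x y z t : (x + y) + (z + t) = (x + z) + (y + t).
Proof. by rewrite -!caddA (caddA y) (caddC y) -caddA. Qed.

Lemma cle_refl x : x <= x.
Proof. by case: CuS => -[_ [_ [_ []]]]. Qed.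

Lemma cle_trans y x z : x <= y -> y <= z -> x <= z.
Proof. by case: CuS => -[_ [_ [_ [_ [+ _]]]]] _; apply. Qed.

Lemma cle_anti x y : x <= y -> y <= x -> x = y.
Proof. by case: CuS => -[_ [_ [_ [_ [_ [+ _]]]]]] _; apply. Qed.

Lemma cle0x x : 0 <= x.
Proof. by case: CuS => -[_ [_ [_ [_ [_ [_ []]]]]]]. Qed.

Lemma cleD x y z t : x <= y -> z <= t -> x + z <= y + t.
Proof.
case: CuS => -[_ [_ [_ [_ [_ [_ [leD2r _]]]]]]] _ xy zt.
apply: (@cle_trans (y + z)); first exact: leD2r.
by rewrite !(caddC y); apply: leD2r.
Qed.

Lemma cle_addr x y : x <= x + y.
Proof. by rewrite -{1}(caddr0 x); apply: cleD; [apply: cle_refl|apply: cle0x]. Qed.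

Lemma cle_addl x y : x <= y + x.
Proof. by rewrite caddC; apply: cle_addr. Qed.

Lemma increasing_le (s : nat -> S) m n :
  increasing s -> (m <= n)%N -> s m <= s n.
Proof.
move=> incs /subnKC <-; elim: (n - m)%N => [|k IH].
  by rewrite addn0; apply: cle_refl.
by rewrite addnS; apply: cle_trans IH _.
Qed.

Lemma nmulD m n x : nmul (m + n)%N x = nmul m x + nmul n x.
Proof. by elim: m => [|m /= ->]; rewrite ?cadd0r // caddA. Qed.

Lemma nmulM m n x : nmul (m * n)%N x = nmul m (nmul n x).
Proof. by elim: m => [//|m IH]; rewrite mulSn nmulD IH. Qed.

Lemma cle_nmul n x y : x <= y -> nmul n x <= nmul n y.
Proof. by move=> xy; elim: n => [|n IH] /=; [apply: cle_refl|apply: cleD]. Qed.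

Lemma increasing_nmul x : increasing (fun n => nmul n x).
Proof. by move=> n; apply: cle_addl. Qed.

Lemma cle_nmul2r m n x : (m <= n)%N -> nmul m x <= nmul n x.
Proof. by apply: (@increasing_le (fun n => nmul n x)); apply: increasing_nmul. Qed.

(** * The way-below relation and suprema *)

Lemma ll_le x y : x <<< y -> x <= y.
Proof.
move=> /(_ (fun=> y) y); case=> //.
- by move=> n; apply: cle_refl.
- by split=> //; split=> [_|z _ /(_ 0%N)]; first exact: cle_refl.
- exact: cle_refl.
Qed.

Lemma ll_cle_trans y x z : x <<< y -> y <= z -> x <<< z.
Proof. by move=> xy yz s w Ps incs sw zw; apply: xy sw _ => //; apply: cle_trans zw. Qed.

Lemma cle_ll_trans y x z : x <= y -> y <<< z -> x <<< z.
Proof.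
move=> xy yz s w Ps incs sw zw; have [m ysm] := yz s w Ps incs sw zw.
by exists m; apply: cle_trans ysm.
Qed.

Lemma ll0x x : 0 <<< x.
Proof. by move=> s z _ _ _ _; exists 0%N; apply: cle0x. Qed.

Lemma llD x' x y' y : x' <<< x -> y' <<< y -> x' + y' <<< x + y.
Proof. by case: CuS => _ [_ [_ [+ _]]]; apply. Qed.

Lemma ll_approx x : exists s : nat -> S,
  [/\ forall n, s n <<< x, increasing s & is_sup s x].
Proof.
case: CuS => _ [_ [/(_ x)[s [lls sx]] _]].
exists s; split=> // n; last exact: ll_le.
by apply: (ll_cle_trans (lls n)); case: sx => _ [].
Qed.

Lemma ll_sup x y (s : nat -> S) :
  increasing s -> is_sup s y -> x <<< y -> exists n, x <= s n.
Proof. by move=> incs sy /(_ s y); apply=> //; apply: cle_refl. Qed.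

Lemma ll_dense x y : x <<< y -> exists2 z, x <<< z & z <<< y.
Proof.
case: CuS => _ [_ [/(_ y)[s [lls sy]] _]].
have incs : increasing s by move=> n; apply: ll_le.
move=> /(ll_sup incs sy)[n xn]; exists (s n.+1); first exact: cle_ll_trans (lls n).
by apply: (ll_cle_trans (lls n.+1)); case: sy => _ [].
Qed.

Lemma ll_sup_ll x y (s : nat -> S) :
  increasing s -> is_sup s y -> x <<< y -> exists n, x <<< s n.
Proof.
move=> incs sy /ll_dense[z xz /(ll_sup incs sy)[n zn]].
by exists n; apply: ll_cle_trans zn.
Qed.

Lemma sup_exists (s : nat -> S) : increasing s -> exists z, is_sup s z.
Proof. by case: CuS => _ [+ _]; apply. Qed.

Lemma sup_le (s : nat -> S) x y : is_sup s x -> (forall n, s n <= y) -> x <= y.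
Proof. by move=> [_ [_]]; apply. Qed.

Lemma sup_ub (s : nat -> S) x n : is_sup s x -> s n <= x.
Proof. by case=> _ []. Qed.

Lemma supD (s t : nat -> S) x y : increasing s -> increasing t ->
  is_sup s x -> is_sup t y -> is_sup (fun n => s n + t n) (x + y).
Proof. by case: CuS => _ [_ [_ [_ +]]]; apply. Qed.

Lemma sup_nmul (s : nat -> S) x n : increasing s -> is_sup s x ->
  is_sup (fun k => nmul n (s k)) (nmul n x).
Proof.
move=> incs sx; elim: n => [|n IH] /=.
  by split=> //; split=> [_|y _ /(_ 0%N)//]; apply: cle_refl.
by apply: supD => // k; apply: cle_nmul.
Qed.

(** By (O4), sums of approximants of [x] and of [y] are cofinal below [x + y]. *)
Lemma ll_le_add z x y : z <<< x + y ->
  exists x' y', [/\ x' <<< x, y' <<< y & z <= x' + y'].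
Proof.
have [s [llx incs sx]] := ll_approx x; have [t [lly inct ty]] := ll_approx y.
have incst : increasing (fun n => s n + t n) by move=> n; apply: cleD.
move=> /(ll_sup incst (supD incs inct sx ty))[n zn].
by exists (s n), (t n).
Qed.

Lemma ll_le_nmul z n x : z <<< nmul n x -> exists2 x', x' <<< x & z <= nmul n x'.
Proof.
have [s [llx incs sx]] := ll_approx x.
have incn : increasing (fun k => nmul n (s k)) by move=> k; apply: cle_nmul.
by move=> /(ll_sup incn (sup_nmul n incs sx))[k zk]; exists (s k).
Qed.

Lemma ll_common x' x'' x : x' <<< x -> x'' <<< x ->
  exists y, [/\ x' <= y, x'' <= y & y <<< x].
Proof.
have [s [llx incs sx]] := ll_approx x.
move=> /(ll_sup incs sx)[m xm] /(ll_sup incs sx)[n xn].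
exists (s (maxn m n)); split=> //.
  by apply: cle_trans xm _; apply: increasing_le => //; apply: leq_maxl.
by apply: cle_trans xn _; apply: increasing_le => //; apply: leq_maxr.
Qed.

Lemma nmul_le_infty n x y : x <= nmul n y -> le_infty x y.
Proof.
move=> xy; have [z yz] := sup_exists (increasing_nmul y).
by exists z; split=> //; apply: cle_trans xy _; apply: (sup_ub n yz).
Qed.

Lemma ll_le_infty x' x y : x' <<< x -> le_infty x y -> exists n, x' <= nmul n y.
Proof.
move=> x'x [z [yz xz]].
exact: (ll_sup (increasing_nmul y) yz (ll_cle_trans x'x xz)).
Qed.

Lemma ll_le_infty_ll x' x y : x' <<< x -> le_infty x y ->
  exists n y', y' <<< y /\ x' <= nmul n y'.
Proof.
move=> /ll_dense[z x'z zx] /(ll_le_infty zx)[n zn].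
by have [y' y'y] := ll_le_nmul (ll_cle_trans x'z zn); exists n, y'.
Qed.

(** * Strongly soft elements and their closure properties *)

(** Interpolating [x' <<< z <<< x] and applying softness to [z] trades the supremum in [le_infty]
    for a finite multiple. *)
Lemma softP x : strongly_soft x <->
  forall x', x' <<< x -> exists t n, x' + t <<< x /\ x' <= nmul n t.
Proof.
split=> softx x' x'x; last first.
  by have [t [n [x't xt]]] := softx _ x'x; exists t; split=> //; apply: nmul_le_infty xt.
have [z x'z zx] := ll_dense x'x; have [t [zt zt_infty]] := softx _ zx.
have [n x'n] := ll_le_infty x'z zt_infty.
exists t, n; split=> //; apply: cle_ll_trans zt.
by apply: cleD; [apply: ll_le|apply: cle_refl].
Qed.

Lemma soft0 : strongly_soft 0.
Proof.
apply/softP => x' /ll_le x'0; exists 0, 0%N; split=> //.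
by rewrite caddr0; apply: (cle_ll_trans x'0); apply: ll0x.
Qed.

Lemma soft_sup (s : nat -> S) x : increasing s ->
  (forall n, strongly_soft (s n)) -> is_sup s x -> strongly_soft x.
Proof.
move=> incs softs sx; apply/softP => x' /(ll_sup_ll incs sx)[n x'n].
have /softP/(_ _ x'n)[t [k [x't x'k]]] := softs n.
by exists t, k; split=> //; apply: ll_cle_trans x't _; apply: sup_ub sx.
Qed.

(** Soft elements are closed under suprema in [S], so it does not matter whether a supremum is taken
    in [S] or in the soft part. *)
Lemma soft_supP (s : nat -> S) x : increasing s ->
  (forall n, strongly_soft (s n)) ->
  is_supP (@strongly_soft S) s x <-> is_sup s x.
Proof.
move=> incs softs; split=> [[_ [ubx lubx]]|sx].
  have [z sz] := sup_exists incs.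
  suff -> : x = z by [].
  apply: cle_anti; last by apply: sup_le sz _.
  by apply: lubx => [|n]; [apply: soft_sup sz|apply: sup_ub sz].
split; first exact: soft_sup sx.
by split=> [n|y _]; [apply: sup_ub|apply: sup_le sx].
Qed.

Lemma soft_add x y : strongly_soft x -> strongly_soft y -> strongly_soft (x + y).
Proof.
move=> /softP softx /softP softy; apply/softP => z /ll_le_add[x' [y' [x'x y'y zxy]]].
have [t [m [xt x'm]]] := softx _ x'x; have [u [n [yu y'n]]] := softy _ y'y.
exists (t + u), (m + n)%N; split.
  apply: (@cle_ll_trans ((x' + t) + (y' + u))); last exact: llD.
  by rewrite caddACA; apply: cleD => //; apply: cle_refl.
apply: cle_trans zxy _; rewrite nmulD; apply: cleD.
  by apply: cle_trans x'm _; apply: cle_nmul; apply: cle_addr.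
by apply: cle_trans y'n _; apply: cle_nmul; apply: cle_addl.
Qed.

Lemma soft_nmul n x : strongly_soft x -> strongly_soft (nmul n x).
Proof. by move=> softx; elim: n => [|n IH]; [apply: soft0|apply: soft_add]. Qed.

(** The room [t] that softness of [e] leaves above [e'] also serves for [e + x]: the approximant
    [x'] of [x] lies below a multiple of [e'], hence of [t]. *)
Lemma soft_add_dominated n e x :
  strongly_soft e -> x <= nmul n e -> strongly_soft (e + x).
Proof.
move=> /softP softe xe; apply/softP => z /ll_le_add[e1 [x' [e1e x'x zle]]].
have [e2 e2e x'e2] := ll_le_nmul (ll_cle_trans x'x xe).
have [e' [e1e' e2e' e'e]] := ll_common e1e e2e.
have [t [m [et e'm]]] := softe _ e'e.
have {x'e2 e2e'} x'e' : x' <= nmul n e'.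
  by apply: cle_trans x'e2 _; apply: cle_nmul.
have {zle e1e'} ze' : z <= e' + x'.
  by apply: cle_trans zle _; apply: cleD => //; apply: cle_refl.
exists t, (m + n * m)%N; split.
  apply: (@cle_ll_trans ((e' + t) + x')); last exact: llD.
  rewrite -caddA (caddC t) caddA; apply: cleD => //; exact: cle_refl.
apply: cle_trans ze' _; rewrite nmulD nmulM; apply: cleD => //.
by apply: cle_trans x'e' _; apply: cle_nmul.
Qed.

(** * Soft elements obtained from divisibility *)

Hypothesis divS : two_omega_divisible S.

(** Bundling [y' <<< y] into one type lets [choice] turn the halving into a function that can be
    iterated. *)
Lemma halving_step (p : {p : S * S | p.1 <<< p.2}) :
  exists q : {p : S * S | p.1 <<< p.2},
    (sval q).2 + (sval q).2 <= (sval p).2 /\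
    exists n, (sval p).1 <= nmul n (sval q).1.
Proof.
case: p => [[y' y] /= /ll_dense[y'' y'y'' /divS[z [zzy y''z]]]].
have [n [z' [z'z y'z']]] := ll_le_infty_ll y'y'' y''z.
by exists (exist (fun p : S * S => p.1 <<< p.2) (z', z) z'z); split=> //; exists n.
Qed.

(* The soft element is the infinite sum of [y'_1, y'_2, ...] with
   [y'_n <<< y_n], [2 y_(n+1) <= y_n] and [y'_n <= oo y'_(n+1)]: the tail of the
   series dominates every partial sum. *)
Lemma soft_below_full x' x : x' <<< x ->
  exists e n, [/\ strongly_soft e, e <= x & x' <= nmul n e].
Proof.
move=> x'x; have [g gP] := choice halving_step.
pose p n := iter n g (exist (fun p : S * S => p.1 <<< p.2) (x', x) x'x).
(* The initial pair [(x', x)] is left out of the sum, so that [2 y_0 <= x]. *)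
pose y' n := (sval (p n.+1)).1; pose y n := (sval (p n.+1)).2.
have y'y n : y' n <<< y n by apply: (svalP (p n.+1)).
have yy n : y n.+1 + y n.+1 <= y n by have [] := gP (p n.+1).
have y0x : y 0%N + y 0%N <= x by have [] := gP (p 0%N).
have [k x'k] : exists k, x' <= nmul k (y' 0%N) by have [] := gP (p 0%N).
have y'S n : exists k, y' n <= nmul k (y' n.+1) by have [] := gP (p n.+1).
pose s := fix s n := if n is m.+1 then s m + y' n else y' 0%N.
have incs : increasing s by move=> n; apply: cle_addr.
(* The spare copy of [y n] pays for all later terms, since [2 y_(n+1) <= y_n]. *)
have s_le n : s n + y n <= x.
  elim: n => [|n IH].
    by apply: cle_trans y0x; apply: cleD; [exact: ll_le (y'y 0%N)|apply: cle_refl].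
  apply: cle_trans IH => /=; rewrite -caddA; apply: cleD; first exact: cle_refl.
  by apply: cle_trans (yy n); apply: cleD; [exact: ll_le (y'y n.+1)|apply: cle_refl].
have s_dom n : exists m, s n <= nmul m (y' n.+1).
  elim: n => [|n [m IH]]; first exact: y'S.
  have [j yj] := y'S n.+1; exists (m.+1 * j)%N.
  rewrite nmulM; apply: (@cle_trans (nmul m.+1 (y' n.+1))); last exact: cle_nmul.
  by rewrite /= caddC; apply: cleD; [apply: cle_refl|].
have [e se] := sup_exists incs; exists e, k; split.
(* The witness [t] is taken way below the next term of the series, which dominates [s n]; then
   [z + t <<< s n.+1]. *)
- apply/softP => z /(ll_sup_ll incs se)[n zn]; have [m snm] := s_dom n.
  have [t ty zt] := ll_le_nmul (ll_cle_trans zn snm).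
  exists t, m; split=> //.
  apply: (@ll_cle_trans (s n.+1)); first exact: llD.
  exact: sup_ub se.
- by apply: (sup_le se) => n; apply: cle_trans (s_le n); apply: cle_addr.
- by apply: cle_trans x'k _; apply: cle_nmul; apply: (sup_ub 0%N se).
Qed.

Lemma small_full k x' x : x' <<< x ->
  exists y n, nmul k y <= x /\ x' <= nmul n y.
Proof.
move=> x'x.
(* Divisibility halves, so the induction runs over powers of two; each halving only enlarges [n]. *)
suff [y [n [ky xn]]] : exists y n, nmul (2 ^ k)%N y <= x /\ x' <= nmul n y.
  exists y, n; split=> //; apply: cle_trans ky; apply: cle_nmul2r.
  by apply: ltnW; apply: ltn_expl.
elim: k x' x'x => [|k IH] x' x'x.
  by exists x, 1%N; rewrite /= caddr0; split; [apply: cle_refl|apply: ll_le].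
have [z x'z /IH[y [n [ky zn]]]] := ll_dense x'x.
have [y1 y1y x'y1] := ll_le_nmul (ll_cle_trans x'z zn).
have [y2 y1y2 y2y] := ll_dense y1y.
have [u [uuy y2u]] := divS y2y; have [m y1m] := ll_le_infty y1y2 y2u.
exists u, (n * m)%N; split; last first.
  by rewrite nmulM; apply: cle_trans x'y1 _; apply: cle_nmul.
apply: cle_trans ky; rewrite expnSr nmulM; apply: cle_nmul.
by rewrite /= caddr0.
Qed.

Lemma soft_small_full k x' x : x' <<< x ->
  exists e n, [/\ strongly_soft e, nmul k e <= x & x' <= nmul n e].
Proof.
move=> /ll_dense[z x'z /(small_full k)[y [n [ky zn]]]].
have [y' y'y x'y'] := ll_le_nmul (ll_cle_trans x'z zn).
have [e [m [softe ey y'e]]] := soft_below_full y'y.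
exists e, (n * m)%N; split=> //; first by apply: cle_trans ky; apply: cle_nmul.
by rewrite nmulM; apply: cle_trans x'y' _; apply: cle_nmul.
Qed.

(** * Soft approximation and the way-below relation of the soft part *)

(** Softness of [x] leaves room for some [t] next to [x']. A soft [e <= t] with a multiple above
    [x'] makes [e + x'] soft by [soft_add_dominated]. *)
Lemma soft_dense x' x : strongly_soft x -> x' <<< x ->
  exists y, [/\ strongly_soft y, x' <= y & y <<< x].
Proof.
move=> softx /ll_dense[z x'z zx]; have [t [zt z_infty]] := softx _ zx.
have [n [t' [t't x't']]] := ll_le_infty_ll x'z z_infty.
have [e [m [softe et t'e]]] := soft_below_full t't.
exists (e + x'); split; last 1 first.
- by apply: cle_ll_trans zt; rewrite caddC; apply: cleD => //; apply: ll_le.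
- apply: (@soft_add_dominated (n * m)) => //; rewrite nmulM.
  by apply: cle_trans x't' _; apply: cle_nmul.
- exact: cle_addl.
Qed.

Lemma soft_approx x : strongly_soft x -> exists s : nat -> S,
  [/\ forall n, strongly_soft (s n), forall n, s n <<< x, increasing s & is_sup s x].
Proof.
move=> softx; have [a [llx inca ax]] := ll_approx x.
pose T := {y : S | strongly_soft y /\ y <<< x}.
(* The next term must lie above both the previous one and [a n]: take a common bound still way below
   [x], then a soft element above it. *)
have step (q : nat * T) : exists r : T,
    sval q.2 <= sval r /\ a q.1 <= sval r.
  case: q => n [y [softy yx]] /=.
  have [z [yz az zx]] := ll_common yx (llx n).
  have [r [softr zr rx]] := soft_dense softx zx.
  by exists (exist _ r (conj softr rx)); split; [apply: cle_trans zr|apply: cle_trans zr].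
have [g gP] := choice step.
pose s := fix s n : T :=
  if n is m.+1 then g (m, s m) else exist _ 0 (conj soft0 (@ll0x x)).
have sx n : sval (s n) <<< x by case: (s n) => ? [].
exists (fun n => sval (s n)); split=> //.
- by move=> n; case: (s n) => ? [].
- by move=> n; case: (gP (n, s n)).
- split=> //; split=> [n|y _ sy]; first exact: ll_le.
  apply: (sup_le ax) => n; apply: cle_trans (sy n.+1).
  by case: (gP (n, s n)).
Qed.

(** Soft approximants of [y] are a test sequence inside the soft part. With [ll_soft], this
    identifies the relative way-below relation with the ambient one. *)
Lemma llP_soft x y : strongly_soft y -> llP (@strongly_soft S) x y -> x <<< y.
Proof.
move=> softy xy; have [s [softs sy incs sup_s]] := soft_approx softy.
have [|m xm] := xy s y softs incs _ (cle_refl y); first exact/soft_supP.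
exact: cle_ll_trans (sy m).
Qed.

Lemma ll_soft x y : x <<< y -> llP (@strongly_soft S) x y.
Proof.
by move=> xy s z softs incs /(soft_supP _ incs softs) sz; apply: xy sz.
Qed.

(** * Covering by soft elements *)

Hypothesis O5S : O5 S.
Hypothesis O6S : O6 S.

(* By (O5), a soft [e] with [k e <= x] has an almost complement [c] in [x].
   Cutting [c] down with (O6) to a part dominated by [e' <<< e], it becomes soft
   after adding [e']. *)
Lemma soft_cover k x' x : x' <<< x ->
  exists e f, [/\ strongly_soft e, strongly_soft f, nmul k e <= x, f <= x
    & x' <= e + f].
Proof.
move=> /ll_dense[x1 x'x1 /ll_dense[x2 x12 x2x]].
(* The extra copy of [e] ensures [e <= x] even when [k = 0]. *)
have [e [n [softe ke x2e]]] := soft_small_full k.+1 x2x.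
have [e0 e0e x1e0] := ll_le_nmul (ll_cle_trans x12 x2e).
have [e' [softe' e0e' e'e]] := soft_dense softe e0e.
have ex : e <= x by apply: cle_trans ke; apply: cle_addr.
have e0x : e + 0 <= x by rewrite caddr0.
have [c [_ [e'c xec]]] := O5S e0x e'e (@ll0x 0).
have x1ec : x1 <= e + c.
  by apply: cle_trans xec; apply: cle_trans (ll_le x12) (ll_le x2x).
(* Here [w <= x1] gives domination by a multiple of [e'], while [w <= c] gives [e' + w <= x]. *)
have [v [w [vx1 [ve [wx1 [wc x'vw]]]]]] := O6S x'x1 x1ec.
exists e, (e' + w); split=> //.
- apply: (@soft_add_dominated n) => //; apply: cle_trans wx1 _.
  by apply: cle_trans x1e0 _; apply: cle_nmul.
- by apply: cle_trans ke; apply: cle_addl.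
- by apply: cle_trans e'c; apply: cleD => //; apply: cle_refl.
- by apply: cle_trans x'vw _; apply: cleD => //; apply: cle_addl.
Qed.

End CuSemigroups.

(** * Extending functionals from the soft part *)

Local Open Scope ereal_scope.

(** Supplies the [k] with which [soft_cover] is invoked: the value [a] of the small piece must fit
    into the gap between [r] and [c]. *)
Lemma small_summand (R : realType) (r : R) (c : \bar R) : (0 <= r)%R -> r%:E < c ->
  exists k : nat, forall a : \bar R, 0 <= a -> k%:R%:E * a <= r%:E -> a + r%:E < c.
Proof.
move=> r0; case: c => [d| |//].
  rewrite lte_fin => rd; have dr : (0 < d - r)%R by rewrite subr_gt0.
  exists (Num.truncn (r / (d - r))%R).+1 => -[a| |//] a0.
    rewrite -EFinM -EFinD lee_fin lte_fin => ka; rewrite -ltrBrDr.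
    have := truncnS_gt (r / (d - r))%R; rewrite ltr_pdivrMr // => /(le_lt_trans ka).
    by rewrite ltr_pM2l ?ltr0n.
  (* Since [k] is a successor, [k * +oo = +oo] exceeds [r], which excludes [a = +oo]. *)
  by rewrite gt0_muley ?lte_fin ?ltr0n.
by move=> _; exists 1%N => -[a| |//] _; rewrite ?mul1e ?ltry.
Qed.

Section Extension.
Variables (R : realType) (S : cu_ops).
Hypotheses (CuS : is_Cu S) (divS : two_omega_divisible S).
Hypotheses (O5S : O5 S) (O6S : O6 S).
Local Notation soft := {x : S | strongly_soft x}.

Definition soft_ext (mu : soft -> \bar R) (x : S) : \bar R :=
  ereal_sup [set mu w | w in [set w : soft | cle (sval w) x]].

Lemma le_soft_ext (mu : soft -> \bar R) (w : soft) x :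
  cle (sval w) x -> mu w <= soft_ext mu x.
Proof. by move=> wx; apply: ereal_sup_ubound; exists w. Qed.

Lemma soft_ext_le (mu : soft -> \bar R) x c :
  (forall w : soft, cle (sval w) x -> mu w <= c) -> soft_ext mu x <= c.
Proof. by move=> muc; apply: ge_ereal_sup => _ [w wx <-]; apply: muc. Qed.

Lemma functional_nmul (mu : soft -> \bar R) (muF : is_functional mu) k (e : soft)
  (h : strongly_soft (nmul k (sval e))) :
  mu (exist _ (nmul k (sval e)) h) = k%:R%:E * mu e.
Proof.
case: muF => mu_ge0 [mu0 [muD _]].
elim: k h => [|k IH] h; first by rewrite mul0e; apply: mu0.
have hk := @soft_nmul _ CuS k _ (svalP e).
rewrite (muD e (exist _ _ hk)) IH -natr1 EFinD addeC.
by rewrite ge0_muleDl ?lee_fin ?ler0n// mul1e.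
Qed.

Section Functional.
Variable mu : soft -> \bar R.
Hypothesis muF : is_functional mu.

Lemma soft_ext_mono x y : cle x y -> soft_ext mu x <= soft_ext mu y.
Proof.
move=> xy; apply: soft_ext_le => w wx; apply: le_soft_ext.
exact: cle_trans wx xy.
Qed.

Lemma soft_ext_ge0 x : 0 <= soft_ext mu x.
Proof.
case: muF => mu_ge0 _; apply: le_trans (mu_ge0 (exist _ _ (soft0 CuS))) _.
by apply: le_soft_ext; apply: cle0x.
Qed.

Lemma soft_ext_soft (w : soft) : soft_ext mu (sval w) = mu w.
Proof.
case: muF => _ [_ [_ [mu_le _]]].
apply/eqP; rewrite eq_le le_soft_ext ?andbT; last exact: cle_refl.
exact: soft_ext_le (fun v => mu_le v w).
Qed.

(** In a cover [e + f] from [soft_cover], both [mu f] and [k * mu e] are at most [soft_ext mu x], so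
    a large [k] keeps [mu (e + f)] below [c]. *)
Lemma soft_ext_cover x' x c : ll x' x -> soft_ext mu x < c ->
  exists2 g : soft, cle x' (sval g) & mu g < c.
Proof.
move=> x'x; case E : (soft_ext mu x) => [r| |]; last first.
- by have := soft_ext_ge0 x; rewrite E.
- by rewrite ltNge leey.
have r0 : (0 <= r)%R by have := soft_ext_ge0 x; rewrite E.
move=> /(small_summand r0)[k kP].
have [e [f [softe softf kex fx x'ef]]] := soft_cover CuS divS O5S O6S k x'x.
exists (exist _ _ (soft_add CuS softe softf)) => //.
have [mu_ge0 [_ [muD _]]] := muF.
rewrite (muD (exist _ e softe) (exist _ f softf)).
apply: (@le_lt_trans _ _ (mu (exist _ e softe) + r%:E)).
  by apply: leeD => //; rewrite -E; apply: le_soft_ext.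
apply: kP => //; rewrite -E -(@functional_nmul _ muF k (exist _ e softe) (@soft_nmul _ CuS k _ softe)).
exact: le_soft_ext.
Qed.

(** A soft [w] below [x] is a supremum of soft elements way below it, and [mu] preserves that
    supremum. *)
Lemma soft_ext_approx x c : (forall w : soft, ll (sval w) x -> mu w <= c) ->
  soft_ext mu x <= c.
Proof.
move=> muc; apply: soft_ext_le => w wx.
have [s [softs sw incs sup_s]] := soft_approx CuS divS (svalP w).
have [_ [_ [_ [_ mu_sup]]]] := muF.
rewrite (mu_sup (fun n => exist _ (s n) (softs n)) w) //; last exact/soft_supP.
apply: ge_ereal_sup => _ [n _ <-]; apply: muc.
exact: ll_cle_trans (sw n) wx.
Qed.

Lemma soft_extD x y : soft_ext mu (cadd x y) = soft_ext mu x + soft_ext mu y.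
Proof.
have [mu_ge0 [_ [muD [mu_le _]]]] := muF.
apply/eqP; rewrite eq_le; apply/andP; split.
  (* Subadditivity: soft covers of [x'] and [y'], each within [d / 2] of the extension's value, add
     up to a soft element above [w]. *)
  apply: soft_ext_approx => w /(ll_le_add CuS)[x' [y' [x'x y'y wxy]]].
  have [->|xfin] := eqVneq (soft_ext mu x) +oo.
    by rewrite addye ?leey// gt_eqF// (lt_le_trans _ (soft_ext_ge0 y)).
  have [->|yfin] := eqVneq (soft_ext mu y) +oo.
    by rewrite addey ?leey// gt_eqF// (lt_le_trans _ (soft_ext_ge0 x)).
  have finx : soft_ext mu x \is a fin_num by rewrite ge0_fin_numE ?soft_ext_ge0 ?ltey.
  have finy : soft_ext mu y \is a fin_num by rewrite ge0_fin_numE ?soft_ext_ge0 ?ltey.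
  apply/lee_addgt0Pr => d d0; have d20 : (0 < d / 2)%R by rewrite divr_gt0.
  have [|g x'g gx] := @soft_ext_cover _ _ (soft_ext mu x + (d / 2)%:E) x'x.
    by rewrite lteDl.
  have [|h y'h hy] := @soft_ext_cover _ _ (soft_ext mu y + (d / 2)%:E) y'y.
    by rewrite lteDl.
  rewrite (splitr d) EFinD addeACA.
  apply: le_trans (leeD (ltW gx) (ltW hy)).
  rewrite -(muD g h (soft_add CuS (svalP g) (svalP h))); apply: mu_le => /=.
  by apply: (cle_trans CuS) wxy _; apply: cleD.
(* Superadditivity: sums of soft elements are soft. The two suprema are then taken one at a time by
   subtraction, hence the finiteness checks. *)
have addle (w v : soft) : cle (sval w) x -> cle (sval v) y ->
    mu w + mu v <= soft_ext mu (cadd x y).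
  move=> wx vy; rewrite -(muD w v (soft_add CuS (svalP w) (svalP v))).
  by apply: le_soft_ext; apply: cleD.
have [->|xyfin] := eqVneq (soft_ext mu (cadd x y)) +oo; first by rewrite leey.
have muxy (w : soft) : cle (sval w) x -> mu w \is a fin_num.
  move=> wx; rewrite ge0_fin_numE//; apply: le_lt_trans (_ : soft_ext mu (cadd x y) < +oo).
    by apply: le_soft_ext; apply: (cle_trans CuS) wx _; apply: cle_addr.
  by rewrite ltey.
have le_y (w : soft) : cle (sval w) x ->
    soft_ext mu y <= soft_ext mu (cadd x y) - mu w.
  move=> wx; apply: soft_ext_le => v vy.
  by rewrite leeBrDl ?muxy//; apply: addle.
have yfin : soft_ext mu y \is a fin_num.
  rewrite ge0_fin_numE ?soft_ext_ge0//.
  apply: le_lt_trans (_ : soft_ext mu (cadd x y) < +oo); last by rewrite ltey.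
  by apply: soft_ext_mono; apply: cle_addl.
rewrite -leeBrDr//; apply: soft_ext_le => w wx.
by rewrite leeBrDr// addeC -leeBrDr ?muxy//; apply: le_y.
Qed.

Lemma soft_ext_sup (s : nat -> S) x : increasing s -> is_sup s x ->
  soft_ext mu x = ereal_sup [set soft_ext mu (s n) | n in setT].
Proof.
move=> incs sx; apply/eqP; rewrite eq_le; apply/andP; split.
  apply: soft_ext_approx => w /(ll_sup CuS incs sx)[n wn].
  apply: le_trans (le_soft_ext mu wn) _.
  by apply: ereal_sup_ubound; exists n.
by apply: ge_ereal_sup => _ [n _ <-]; apply: soft_ext_mono; apply: sup_ub sx.
Qed.

Lemma soft_ext_functional :
  is_functional (fun x : {x : S | allS x} => soft_ext mu (sval x)).
Proof.
split; first by move=> x; apply: soft_ext_ge0.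
split.
  move=> h /=; have [_ [mu0 _]] := muF.
  by rewrite (soft_ext_soft (exist _ _ (soft0 CuS))).
split; first by move=> x y h; apply: soft_extD.
split; first by move=> x y; apply: soft_ext_mono.
by move=> s z incs sz; apply: (@soft_ext_sup (fun n => sval (s n))).
Qed.

End Functional.

(** * The restriction map and convergence *)

Lemma iota_star_functional (lam : {x : S | allS x} -> \bar R) :
  is_functional lam -> is_functional (iota_star lam).
Proof.
move=> [lam_ge0 [lam0 [lamD [lam_le lam_sup]]]].
split; first by move=> x; apply: lam_ge0.
split; first by move=> h; apply: lam0.
split; first by move=> x y h; apply: (lamD (exist _ (sval x) I) (exist _ (sval y) I)).
split; first by move=> x y xy; apply: lam_le.
move=> s z incs sz; rewrite /iota_star.
rewrite (lam_sup (fun n => exist _ (sval (s n)) I) (exist _ (sval z) I)) //=.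
exact: ((soft_supP CuS _ incs (fun n => svalP (s n))).1 sz).
Qed.

Lemma soft_ext_iota_star (lam : {x : S | allS x} -> \bar R) x :
  is_functional lam -> soft_ext (iota_star lam) (sval x) = lam x.
Proof.
move=> lamF; have iF := iota_star_functional lamF.
have [_ [_ [_ [lam_le lam_sup]]]] := lamF.
apply/eqP; rewrite eq_le; apply/andP; split.
  by apply: soft_ext_le => w wx; apply: lam_le.
have [s [sx incs sup_s]] := ll_approx CuS (sval x).
rewrite (lam_sup (fun n => exist _ (s n) I) x) //.
apply: ge_ereal_sup => _ [n _ <-]; rewrite leNgt; apply/negP.
(* Otherwise some soft [g] above [s n] would satisfy [lam g < lam (s n)], against monotonicity. *)
move=> /(soft_ext_cover iF (sx n))[g sg]; apply/negP; rewrite -leNgt.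
exact: lam_le.
Qed.

Lemma F_converges_iota_star (I : Type) (leI : I -> I -> Prop)
    (net : I -> {x : S | allS x} -> \bar R) (lam : {x : S | allS x} -> \bar R) :
  F_converges leI net lam ->
  F_converges leI (fun i => iota_star (net i)) (iota_star lam).
Proof.
move=> cvg x' x /(llP_soft CuS divS (svalP x)) x'x.
exact: (cvg (exist _ (sval x') Logic.I) (exist _ (sval x) Logic.I)).
Qed.

Lemma iota_star_F_converges (I : Type) (leI : I -> I -> Prop)
    (net : I -> {x : S | allS x} -> \bar R) (lam : {x : S | allS x} -> \bar R) :
  (forall i, is_functional (net i)) -> is_functional lam ->
  F_converges leI (fun i => iota_star (net i)) (iota_star lam) ->
  F_converges leI net lam.
Proof.
move=> netF lamF cvg x' x x'x.
have net_le i (y z : {x : S | allS x}) : cle (sval y) (sval z) -> net i y <= net i z.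
  by case: (netF i) => _ [_ [_ [+ _]]]; apply.
split=> c.
  have [x1 x'1 x1x] := ll_dense CuS x'x.
  rewrite -(soft_ext_iota_star x lamF).
  (* Limit superior: a soft cover [g] with [lam g < c], and a soft [g' <<< g] still above [x'],
     reduce the bound to the soft pair [g'], [g]. *)
  move=> /(soft_ext_cover (iota_star_functional lamF) x1x)[g x1g gc].
  have x'g := ll_cle_trans CuS x'1 x1g.
  have [g' [softg' x'g' g'g]] := soft_dense CuS divS (svalP g) x'g.
  have [+ _] := cvg (exist _ g' softg') g (ll_soft CuS g'g).
  move=> /(_ c gc)[i0 i0P]; exists i0 => i /i0P; apply: le_lt_trans.
  exact: net_le.
(* Limit inferior: a soft [w <= x] with [lam w > c] suffices; the pair [0 <<< w] serves only to
   invoke soft convergence at [w]. *)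
rewrite -(soft_ext_iota_star x lamF) => /ereal_sup_gt[_ [w wx <-] cw].
have [_] := cvg (exist _ _ (soft0 CuS)) w (ll_soft CuS (@ll0x _ CuS _)).
move=> /(_ c cw)[i0 i0P]; exists i0 => i /i0P /lt_le_trans; apply.
exact: net_le.
Qed.

End Extension.

Theorem theorem5p14 (R : realType) (S : cu_ops) :
  is_Cu S -> two_omega_divisible S -> O5 S -> O6 S -> O7 S ->
  (* iota^* maps F(S) into F(S_soft) *)
  (forall lam, @is_functional R S (@allS S) lam ->
     @is_functional R S (@strongly_soft S) (@iota_star R S lam)) /\
  (* iota^* is injective on F(S) *)
  (forall lam1 lam2, @is_functional R S (@allS S) lam1 ->
     @is_functional R S (@allS S) lam2 ->
     @iota_star R S lam1 = @iota_star R S lam2 -> lam1 = lam2) /\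
  (* iota^* is onto F(S_soft) *)
  (forall mu, @is_functional R S (@strongly_soft S) mu ->
     exists lam, @is_functional R S (@allS S) lam /\ @iota_star R S lam = mu) /\
  (* iota^* and its inverse are continuous: a net in F(S) converges
     iff its image under iota^* converges to the image of the limit *)
  (forall (I : Type) (leI : I -> I -> Prop)
          (net : I -> {x : S | allS x} -> \bar R) (lam : {x : S | allS x} -> \bar R),
     directed leI ->
     (forall i, @is_functional R S (@allS S) (net i)) ->
     @is_functional R S (@allS S) lam ->
     (@F_converges R S (@allS S) I leI net lam <->
      @F_converges R S (@strongly_soft S) I leI
        (fun i => @iota_star R S (net i)) (@iota_star R S lam))).
Proof.
move=> CuS divS O5S O6S _; split; first exact: iota_star_functional.
split.
  move=> lam1 lam2 lam1F lam2F eq12; apply/funext => x.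
  rewrite -(soft_ext_iota_star CuS divS O5S O6S x lam1F) eq12.
  exact: soft_ext_iota_star.
split.
  move=> mu muF; exists (fun x => soft_ext mu (sval x)).
  split; first exact: soft_ext_functional.
  by apply/funext => w; apply: soft_ext_soft.
move=> I leI net lam _ netF lamF; split; first exact: F_converges_iota_star.
exact: iota_star_F_converges.
Qed.
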